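(* Let $(\mathfrak g,H,\mathcal G_g)$ be a generalised Riemannian Lie algebra, $\delta\in E^*=(\mathfrak g\oplus\mathfrak g^* )^*$ a divergence operator, $\mathfrak g'=[\mathfrak g,\mathfrak g]$ and $\mathfrak h:=(\mathfrak g')^\perp$. Then $(\mathfrak g,H,\mathcal G_g,\delta)$ is generalised Einstein if and only if all of the following hold: - $\mathfrak h$ is an Abelian Lie subalgebra of $\mathfrak g$ which acts skew-symmetrically on $\mathfrak g'$ (i.e. $\mathrm{ad}_X|_{\mathfrak g'}$ is $g$-skew-symmetric for all $X\in\mathfrak h$); - $\delta([\mathfrak h,\mathfrak g']\oplus[\mathfrak h,\mathfrak g']^\flat)=0$; - $H(X,\cdot,\cdot)=0$ for all $X\in\mathfrak h$; - $(\mathfrak g',H|_{\mathfrak g'},\mathcal G_{g|_{\mathfrak g'}},\delta|_{\mathfrak g'\oplus(\mathfrak g')^*})$ is generalised Einstein. In this case $\mathfrak g\cong\mathfrak g'\rtimes\mathbb R^m$ as Lie algebras with $m=\dim\mathfrak h$, and $H$ may be considered as a three-form on $\mathfrak g'$ (i.e. $H$ is the pull-back of $H|_{\mathfrak g'}$ under the orthogonal projection $\mathfrak g\to\mathfrak g'$).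
   Context: Let $\mathfrak g$ be a finite-dimensional real Lie algebra. A generalised pseudo-Riemannian metric on $\mathfrak g$ is a pair $(H,\mathcal G_g)$ where $H\in\Lambda^3\mathfrak g^*$ is closed for the Chevalley–Eilenberg differential (normalised by $d\alpha(X,Y)=-\alpha([X,Y])$), $g$ is a non-degenerate symmetric bilinear form on $\mathfrak g$, and $\mathcal G_g$ is the endomorphism of $E=\mathfrak g\oplus\mathfrak g^*$ given by $\mathcal G_g(X+\xi)=\xi^\sharp+X^\flat$, with $X^\flat=g(X,\cdot)$ and $\sharp=\flat^{-1}$; then $(\mathfrak g,H,\mathcal G_g)$ is called a generalised pseudo-Riemannian Lie algebra, and a generalised Riemannian Lie algebra if $g$ is positive definite. Let $E_\pm=\{X\pm X^\flat\mid X\in\mathfrak g\}$ be the $\pm1$-eigenspaces of $\mathcal G_g$ and $\pi_\pm=\frac12(\mathrm{id}\pm\mathcal G_g):E\to E_\pm$. The $H$-twisted Dorfman bracket on $E$ is $[X+\xi,Y+\eta]_H=[X,Y]+d\eta(X,\cdot)-d\xi(Y,\cdot)+H(X,Y,\cdot)$. A divergence operator is an element $\delta\in E^*$. For $u\in E_+$, $v\in E_-$ put $\Gamma_u=\pi_+\circ[u,\cdot]_H|_{E_-}:E_-\to E_+$ and $\Gamma_v=\pi_-\circ[v,\cdot]_H|_{E_+}:E_+\to E_-$. The generalised Ricci curvatures of $(\mathcal G_g,\delta)$ are, by a known result taken here as definition, $\mathcal{RC}^+(v,u)=-\mathrm{tr}(\Gamma_v\circ\Gamma_u)+\delta(\pi_+[v,u]_H)$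 and $\mathcal{RC}^-(u,v)=-\mathrm{tr}(\Gamma_v\circ\Gamma_u)+\delta(\pi_-[u,v]_H)$. The quadruple $(\mathfrak g,H,\mathcal G_g,\delta)$ is generalised Einstein if $\mathcal{RC}^+=0$ and $\mathcal{RC}^-=0$ (for all $u\in E_+$, $v\in E_-$). The dual space $(\mathfrak g')^*$ is regarded as the subspace $(\mathfrak g')^\flat\subseteq\mathfrak g^*$ (the forms vanishing on $\mathfrak h$). *)

(* Defs.v *)
From HB Require Import structures.
From mathcomp Require Import all_boot all_order all_algebra reals ring.

Set Implicit Arguments.
Unset Strict Implicit.
Unset Printing Implicit Defensive.

Import Order.TTheory GRing.Theory Num.Theory.
Local Open Scope ring_scope.

Notation dual V := 'Hom(V, _^o).

(* V (+) V^*; the element X + xi is the pair (X, xi) *)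
Notation gtan V := (V * dual V)%type.

Lemma linfunE (R : fieldType) (aT rT : vectType R) (f : aT -> rT) :
  linear f -> linfun f =1 f.
Proof.
move=> f_lin; pose fM := GRing.isLinear.Build _ _ _ _ f f_lin.
by pose ff : {linear aT -> rT} := HB.pack f fM; apply: (lfunE ff).
Qed.

Section Linear.
Variables (R : fieldType) (V : vectType R).

Definition incl (U : {vspace V}) : 'Hom(subvs_of U, V) :=
  linfun (vsval : subvs_of U -> V).

Lemma inclE U x : incl U x = vsval x. Proof. exact: lfunE. Qed.

Definition lftrace (f : 'End(V)) : R :=
  \tr (passmx.mxof (vbasis {:V}) (vbasis {:V}) f).

End Linear.

Section Lie.
Variable R : fieldType.

Record lieAlgebra (V : vectType R) := LieAlgebra {
  bracket :> {bilinear V -> V -> V};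
  bracket_alt : forall x, bracket x x = 0;
  bracket_jacobi : forall x y z,
    bracket x (bracket y z) + bracket y (bracket z x)
      + bracket z (bracket x y) = 0
}.

Section LieTheory.
Variables (V : vectType R) (b : lieAlgebra V).

Definition ad (x : V) : 'End(V) := linfun (b x).

Lemma adE x y : ad x y = b x y. Proof. exact: lfunE. Qed.

Lemma bracketC x y : b x y = - b y x.
Proof.
apply/eqP; rewrite -addr_eq0; apply/eqP.
have := bracket_alt b (x + y).
by rewrite linearDl !linearDr /= !bracket_alt add0r addr0.
Qed.

(* the span [U, W] of the brackets of an element of U and an element of W *)
Definition brv (U W : {vspace V}) : {vspace V} :=
  <<[seq b x y | x <- vbasis U, y <- vbasis W]>>%VS.

Lemma mem_brv (U W : {vspace V}) x y : x \in U -> y \in W -> b x y \in brv U W.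
Proof.
move=> /coord_vbasis-> /coord_vbasis->; rewrite linear_sumlz.
rewrite rpred_sum // => i _.
rewrite linear_sumr rpred_sum // => j _.
rewrite linearZl_LR linearZr_LR !rpredZ //; apply/memv_span/allpairsP.
by exists ((vbasis U)`_i, (vbasis W)`_j); rewrite !mem_nth ?size_tuple.
Qed.

Definition derived : {vspace V} := brv fullv fullv.

Definition lie_closed (U : {vspace V}) : Prop :=
  {in U &, forall x y, b x y \in U}.

Lemma derived_closed : lie_closed derived.
Proof. by move=> x y _ _; rewrite mem_brv ?memvf. Qed.

Definition abelian_subalgebra (U : {vspace V}) : Prop :=
  lie_closed U /\ {in U &, forall x y, b x y = 0}.

End LieTheory.

(* The bracket of a subalgebra U, on the type of its elements. *)
Definition sub_bracket (V : vectType R) (b : {bilinear V -> V -> V})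
    {U : {vspace V}} (x y : subvs_of U) : subvs_of U :=
  vsproj U (b (vsval x) (vsval y)).

Section SubBilinear.
Variables (V : vectType R) (b : {bilinear V -> V -> V}) (U : {vspace V}).

Fact sub_bracket_bilinear : bilinear_for *:%R *:%R (@sub_bracket V b U).
Proof.
by split=> z a x y; rewrite /sub_bracket ?linearPl ?linearPr /= linearP.
Qed.
HB.instance Definition _ := bilinear_isBilinear.Build _ _ _ _ _ _
  (@sub_bracket V b U) sub_bracket_bilinear.

End SubBilinear.

Section SubLie.
Variables (V : vectType R) (b : lieAlgebra V) (U : {vspace V}).
Hypothesis bU : lie_closed b U.

Fact sub_bracket_alt (x : subvs_of U) : sub_bracket b x x = 0.
Proof. by rewrite /sub_bracket bracket_alt linear0. Qed.

Lemma sub_bracketE (x y : subvs_of U) :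
  vsval (sub_bracket b x y) = b (vsval x) (vsval y).
Proof. by rewrite vsprojK ?bU ?subvsP. Qed.

Fact sub_bracket_jacobi (x y z : subvs_of U) :
  sub_bracket b x (sub_bracket b y z) + sub_bracket b y (sub_bracket b z x)
    + sub_bracket b z (sub_bracket b x y) = 0.
Proof.
by apply: subvs_inj; rewrite 2!linearD /= !sub_bracketE bracket_jacobi.
Qed.

Definition sub_lie : lieAlgebra (subvs_of U) :=
  @LieAlgebra _ (@sub_bracket V b U) sub_bracket_alt sub_bracket_jacobi.

End SubLie.

Definition derived_lie (V : vectType R) (b : lieAlgebra V) :=
  sub_lie (@derived_closed V b).

Definition lie_isomorphic (V W : vectType R)
    (b : lieAlgebra V) (c : lieAlgebra W) : Prop :=
  exists2 f : 'Hom(V, W), bijective f & forall x y, f (b x y) = c (f x) (f y).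

Section AbelianLie.
Variable V : vectType R.

Definition zero_bracket (x y : V) : V := 0.

Fact zero_bracket_bilinear : bilinear_for *:%R *:%R zero_bracket.
Proof. by split=> z a x y; rewrite /zero_bracket /= scaler0 addr0. Qed.
HB.instance Definition _ := bilinear_isBilinear.Build _ _ _ _ _ _
  zero_bracket zero_bracket_bilinear.

Fact zero_bracket_alt x : zero_bracket x x = 0. Proof. by []. Qed.
Fact zero_bracket_jacobi (x y z : V) :
  zero_bracket x (zero_bracket y z) + zero_bracket y (zero_bracket z x)
    + zero_bracket z (zero_bracket x y) = 0.
Proof. by rewrite /zero_bracket !addr0. Qed.

Definition abelian_lie : lieAlgebra V :=
  LieAlgebra zero_bracket_alt zero_bracket_jacobi.

End AbelianLie.

Section Semidirect.
Variables (A B : vectType R) (bA : lieAlgebra A) (bB : lieAlgebra B).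

(* A Lie algebra homomorphism from B to the derivations of A. *)
Record lieAction := LieAction {
  action :> 'Hom(B, 'End(A));
  action_der : forall x a a',
    action x (bA a a') = bA (action x a) a' + bA a (action x a');
  action_hom : forall x y a,
    action (bB x y) a = action x (action y a) - action y (action x a)
}.

Definition semidirect_bracket (rho : lieAction) (u v : A * B) : A * B :=
  (bA u.1 v.1 + rho u.2 v.1 - rho v.2 u.1, bB u.2 v.2).

Variable rho : lieAction.

Fact semidirect_bracket_bilinear :
  bilinear_for *:%R *:%R (semidirect_bracket rho).
Proof.
split=> z a x y; congr (_, _); rewrite /= ?linearPl ?linearPr //= !linearP /=.
  rewrite add_lfunE scale_lfunE.
  by rewrite !scalerDr [RHS]addrACA [X in _ = X + _]addrACA.
rewrite add_lfunE scale_lfunE [- (_ + _)]opprD -scalerN.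
by rewrite !scalerDr [RHS]addrACA [X in _ = X + _]addrACA.
Qed.
HB.instance Definition _ := bilinear_isBilinear.Build _ _ _ _ _ _
  (semidirect_bracket rho) semidirect_bracket_bilinear.

Fact semidirect_bracket_alt u : semidirect_bracket rho u u = 0.
Proof.
by rewrite /semidirect_bracket !bracket_alt add0r subrr.
Qed.

Fact semidirect_bracket_jacobi u v w :
  semidirect_bracket rho u (semidirect_bracket rho v w)
    + semidirect_bracket rho v (semidirect_bracket rho w u)
    + semidirect_bracket rho w (semidirect_bracket rho u v) = 0.
Proof.
case: u v w => [a x] [a' y] [a'' z].
congr (_, _); last exact: bracket_jacobi.
rewrite /= !action_hom !linearB /= !linearD /= !action_der !linearN /=.
rewrite (bracketC bA (rho x a')) (bracketC bA (rho y a'')).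
rewrite (bracketC bA (rho z a)); have := bracket_jacobi bA a a' a''.
move: (bA a (bA _ _)) (bA a' (bA _ _)) (bA a'' (bA _ _)) => j1 j2 j3.
move: (bA a (rho y _)) (bA a (rho z _)) (bA a' (rho x _)) => k1 k2 k3.
move: (bA a' (rho z _)) (bA a'' (rho x _)) (bA a'' (rho y _)) => k4 k5 k6.
move: (rho x (rho y _)) (rho x (rho z _)) (rho y (rho z _)) => m1 m2 m3.
move: (rho y (rho x _)) (rho z (rho x _)) (rho z (rho y _)) => m4 m5 m6.
move=> jac; rewrite -[RHS]jac [LHS](coord_vbasis (memvf _)).
rewrite [RHS](coord_vbasis (memvf _)); apply: eq_bigr => i _; congr (_ *: _).
by rewrite !(linearD, linearN) /=; ring.
Qed.

Definition semidirect : lieAlgebra (A * B)%type :=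
  LieAlgebra semidirect_bracket_alt semidirect_bracket_jacobi.

End Semidirect.
End Lie.

Section ThreeForms.
Variable R : fieldType.

(* A three-form is given by its values H X Y = H(X, Y, .).  The differential  *)
(* is (d H)(X_0, .., X_3) =                                                   *)
(*   \sum_(i < j) (-1)^(i + j) H([X_i, X_j], X_0, .., ^X_i, .., ^X_j, .., X_3)*)
Definition ce_diff3 (V : vectType R) (b : lieAlgebra V)
    (H : V -> V -> dual V) (x0 x1 x2 x3 : V) : R :=
  - H (b x0 x1) x2 x3 + H (b x0 x2) x1 x3 - H (b x0 x3) x1 x2
    - H (b x1 x2) x0 x3 + H (b x1 x3) x0 x2 - H (b x2 x3) x0 x1.

Record closed3form (V : vectType R) (b : lieAlgebra V) := Closed3form {
  form3 :> {bilinear V -> V -> dual V};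
  form3_alt12 : forall x y, form3 x x y = 0;
  form3_alt23 : forall x y, form3 x y y = 0;
  form3_closed : forall x0 x1 x2 x3, ce_diff3 b form3 x0 x1 x2 x3 = 0
}.

(* The restriction of a three-form to a subspace U. *)
Definition sub_form3 (V : vectType R) (H : {bilinear V -> V -> dual V})
    {U : {vspace V}} (x y : subvs_of U) : dual (subvs_of U) :=
  (H (vsval x) (vsval y) \o incl U)%VF.

Section SubForm.
Variables (V : vectType R) (U : {vspace V}).

Lemma sub_form3E (H : {bilinear V -> V -> dual V}) (x y z : subvs_of U) :
  sub_form3 H x y z = H (vsval x) (vsval y) (vsval z).
Proof. by rewrite comp_lfunE inclE. Qed.

Fact sub_form3_bilinear (H : {bilinear V -> V -> dual V}) :
  bilinear_for *:%R *:%R (@sub_form3 V H U).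
Proof.
split=> z a x y; rewrite /sub_form3 /= ?linearPl ?linearPr /=.
  by rewrite comp_lfunDl comp_lfunZl.
by rewrite comp_lfunDl comp_lfunZl.
Qed.
HB.instance Definition _ (H : {bilinear V -> V -> dual V}) :=
  bilinear_isBilinear.Build _ _ _ _ _ _ (@sub_form3 V H U)
    (sub_form3_bilinear H).

Variables (b : lieAlgebra V) (bU : lie_closed b U) (H : closed3form b).

Fact sub_form3_alt12 (x y : subvs_of U) : sub_form3 H x x y = 0.
Proof. by rewrite sub_form3E form3_alt12. Qed.
Fact sub_form3_alt23 (x y : subvs_of U) : sub_form3 H x y y = 0.
Proof. by rewrite sub_form3E form3_alt23. Qed.
Fact sub_form3_closed (x0 x1 x2 x3 : subvs_of U) :
  ce_diff3 (sub_lie bU) (sub_form3 H) x0 x1 x2 x3 = 0.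
Proof.
by rewrite /ce_diff3 !sub_form3E !sub_bracketE //; exact: (form3_closed H).
Qed.

Definition sub_closed3form : closed3form (sub_lie bU) :=
  @Closed3form _ (sub_lie bU) (@sub_form3 V H U)
    sub_form3_alt12 sub_form3_alt23 sub_form3_closed.

End SubForm.
End ThreeForms.

(* The restriction of a metric to a subspace U. *)
Definition sub_metric (R : numFieldType) (V : vectType R) (g : {symmetric V})
    {U : {vspace V}} (x y : subvs_of U) : R := g (vsval x) (vsval y).

Section SubMetric.
Variables (R : numFieldType) (V : vectType R) (U : {vspace V}).

Fact sub_metric_bilinear (g : {symmetric V}) :
  bilinear_for *%R (idfun \; *%R) (@sub_metric R V g U).
Proof.
by split=> z a x y; rewrite /sub_metric /= ?linearPl ?linearPr /=.
Qed.
HB.instance Definition _ (g : {symmetric V}) :=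
  bilinear_isBilinear.Build _ _ _ _ _ _ (@sub_metric R V g U)
    (sub_metric_bilinear g).

Fact sub_metric_sym (g : {symmetric V}) (x y : subvs_of U) :
  sub_metric g x y = (-1) ^+ false * idfun (sub_metric g y x).
Proof. exact: hermC. Qed.
HB.instance Definition _ (g : {symmetric V}) :=
  isHermitianSesquilinear.Build _ _ _ _ (@sub_metric R V g U)
    (sub_metric_sym g).

Fact sub_metric_gt0 (g : {dot V for idfun}) (x : subvs_of U) :
  x != 0 -> 0 < sub_metric g x x.
Proof. by move=> x0; rewrite neq0_dnorm_gt0. Qed.
HB.instance Definition _ (g : {dot V for idfun}) :=
  isDotProduct.Build _ _ (@sub_metric R V g U) (sub_metric_gt0 g).

End SubMetric.

Section GeneralisedMetric.
Variables (R : numFieldType) (V : vectType R) (g : {symmetric V}).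
Local Notation E := (gtan V).

Definition flat : 'Hom(V, dual V) :=
  linfun (fun x => linfun (g x : V -> R^o) : dual V).

(* the inverse of flat, for a non-degenerate g *)
Definition sharp : 'Hom(dual V, V) := (flat^-1)%VF.

Definition gen_metric : 'End(E) :=
  linfun (fun e : E => (sharp e.2, flat e.1) : E).

Definition Eplus : {vspace E} := limg (linfun (fun x : V => (x, flat x) : E)).
Definition Eminus : {vspace E} :=
  limg (linfun (fun x : V => (x, - flat x) : E)).

Definition pi_plus : 'Hom(E, subvs_of Eplus) :=
  linfun (fun e : E => vsproj Eplus (2^-1 *: (e + gen_metric e))).
Definition pi_minus : 'Hom(E, subvs_of Eminus) :=
  linfun (fun e : E => vsproj Eminus (2^-1 *: (e - gen_metric e))).

Lemma flatE x y : flat x y = g x y.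
Proof.
rewrite linfunE ?lfunE // => a u v; apply/lfunP => w.
by rewrite add_lfunE scale_lfunE !lfunE /= linearPl.
Qed.

Lemma flat_lker : nondegenerate g -> lker flat == 0%VS.
Proof.
move=> /eqP g0; apply/lker0P; apply: raddf_inj => x x0.
apply/eqP; rewrite -memv0 -g0; apply/mem_orthovP => y _.
by rewrite -flatE x0 zero_lfunE.
Qed.

Lemma flatK : nondegenerate g -> cancel flat sharp.
Proof. by move/flat_lker/lker0_lfunK. Qed.

Lemma sharpK : nondegenerate g -> cancel sharp flat.
Proof.
move/flat_lker => f0 xi; apply: limg_lfunVK.
suff -> : limg flat = fullv by rewrite memvf.
apply/eqP; rewrite eqEdim subvf limg_dim_eq ?(eqP f0) ?capv0 //.
by rewrite !dimvf /dim /= muln1.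
Qed.

Lemma gen_metricE x xi : gen_metric (x, xi) = (sharp xi, flat x).
Proof.
by rewrite linfunE // => a [u u'] [v v']; rewrite !linearP.
Qed.

Lemma EplusP e : reflect (exists x, e = (x, flat x)) (e \in Eplus).
Proof.
have lin : linear (fun x : V => (x, flat x) : E).
  by move=> a u v; rewrite linearP.
by apply: (iffP memv_imgP) => [[x _ ->]|[x ->]]; exists x;
  rewrite ?memvf ?(linfunE lin).
Qed.

Lemma EminusP e : reflect (exists x, e = (x, - flat x)) (e \in Eminus).
Proof.
have lin : linear (fun x : V => (x, - flat x) : E).
  by move=> a u v; rewrite linearP opprD -scalerN.
by apply: (iffP memv_imgP) => [[x _ ->]|[x ->]]; exists x;
  rewrite ?memvf ?(linfunE lin).
Qed.

Lemma pi_plusE e : nondegenerate g ->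
  vsval (pi_plus e) = 2^-1 *: (e + gen_metric e).
Proof.
move=> g0; rewrite linfunE; last first.
  move=> a u v; rewrite linearP -(linearP (vsproj _)); congr (vsproj _ _).
  by rewrite addrACA -scalerDr !scalerDr !scalerA (mulrC a).
apply: vsprojK; apply/EplusP; exists (2^-1 *: (e.1 + sharp e.2)).
case: e => x xi; rewrite gen_metricE [X in _ = (_, X)]linearZ.
by rewrite [X in _ = (_, _ *: X)]linearD /= sharpK // [flat x + _]addrC.
Qed.

Lemma pi_minusE e : nondegenerate g ->
  vsval (pi_minus e) = 2^-1 *: (e - gen_metric e).
Proof.
move=> g0; rewrite linfunE; last first.
  move=> a u v; rewrite linearP -(linearP (vsproj _)); congr (vsproj _ _).
  by rewrite opprD addrACA -scalerBr !scalerDr !scalerA (mulrC a).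
apply: vsprojK; apply/EminusP; exists (2^-1 *: (e.1 - sharp e.2)).
case: e => x xi; rewrite gen_metricE [X in _ = (_, - X)]linearZ.
by rewrite [X in _ = (_, - (_ *: X))]linearB /= sharpK // -scalerN opprB.
Qed.

Lemma pi_addE e : nondegenerate g -> vsval (pi_plus e) + vsval (pi_minus e) = e.
Proof.
move=> g0; rewrite pi_plusE // pi_minusE // -scalerDr addrACA subrr addr0.
by rewrite -mulr2n -scaler_nat scalerA mulVf ?pnatr_eq0 // scale1r.
Qed.

End GeneralisedMetric.

Lemma dot_nondegenerate (R : numFieldType) (V : vectType R)
  (g : {dot V for idfun}) : nondegenerate g.
Proof.
apply/eqP/vspaceP => x; rewrite memv0; apply/mem_orthovP/eqP => [x0|-> y _].
  apply: contra_eq (x0 x (memvf _)) => /(neq0_dnorm_gt0 (s := g)).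
  by rewrite lt0r => /andP[].
by rewrite linear0l.
Qed.

Section Dorfman.
Variables (R : numFieldType) (V : vectType R) (b : lieAlgebra V).
Local Notation E := (gtan V).

(* d alpha (x, .), with d alpha (x, y) = - alpha [x, y] *)
Definition ce_diff1 (alpha : dual V) (x : V) : dual V := - (alpha \o ad b x)%VF.

Lemma ce_diff1E alpha x y : ce_diff1 alpha x y = - alpha (b x y).
Proof. by rewrite opp_lfunE comp_lfunE adE. Qed.

Variables (H : closed3form b).

Definition dorfman (e f : E) : E :=
  (b e.1 f.1, ce_diff1 f.2 e.1 - ce_diff1 e.2 f.1 + H e.1 f.1).

Fact dorfman_linear e : linear (dorfman e).
Proof.
move=> a [x xi] [y eta]; congr (_, _); rewrite /= ?linearPr //=.
apply/lfunP => z.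
rewrite !(add_lfunE, scale_lfunE, opp_lfunE, comp_lfunE, adE).
rewrite linearPl (linearP e.2) /=.
by rewrite /GRing.scale /=; ring.
Qed.
End Dorfman.

Section Einstein.
Variables (R : numFieldType) (V : vectType R) (b : lieAlgebra V).
Variables (H : closed3form b) (g : {symmetric V}) (delta : dual (gtan V)).
Local Notation Ep := (subvs_of (Eplus g)).
Local Notation Em := (subvs_of (Eminus g)).

Definition Gamma_plus (u : Ep) : 'Hom(Em, Ep) :=
  (pi_plus g \o linfun (dorfman H (vsval u)) \o incl (Eminus g))%VF.
Definition Gamma_minus (v : Em) : 'Hom(Ep, Em) :=
  (pi_minus g \o linfun (dorfman H (vsval v)) \o incl (Eplus g))%VF.

Definition RCplus (v : Em) (u : Ep) : R :=
  - lftrace (Gamma_minus v \o Gamma_plus u)%VF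
  + delta (vsval (pi_plus g (dorfman H (vsval v) (vsval u)))).
Definition RCminus (u : Ep) (v : Em) : R :=
  - lftrace (Gamma_minus v \o Gamma_plus u)%VF
  + delta (vsval (pi_minus g (dorfman H (vsval u) (vsval v)))).

Definition generalised_einstein : Prop :=
  forall (u : Ep) (v : Em), RCplus v u = 0 /\ RCminus u v = 0.

End Einstein.

Section Restriction.
Variables (R : numFieldType) (V : vectType R) (g : {symmetric V}).
Variables (U : {vspace V}).

(* U (+) U^* inside V (+) V^*, with U^* identified with the flat of U in V^*. *)
Definition gtan_incl : 'Hom(gtan (subvs_of U), gtan V) :=
  linfun (fun e : gtan (subvs_of U) =>
    (vsval e.1, flat g (vsval (sharp (@sub_metric R V g U) e.2))) : gtan V).

Lemma gtan_inclE x xi : gtan_incl (x, xi) =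
  (vsval x, flat g (vsval (sharp (@sub_metric R V g U) xi))).
Proof. by rewrite linfunE // => a [u u'] [v v']; rewrite !linearP. Qed.

Definition sub_divergence (delta : dual (gtan V)) : dual (gtan (subvs_of U)) :=
  (delta \o gtan_incl)%VF.

(* The g-orthogonal projection onto U (for g positive definite). *)
Definition orth_proj : 'Hom(V, subvs_of U) :=
  (linfun (vsproj U) \o daddv_pi U (orthov g U))%VF.

End Restriction.

Section RestrictionTheory.
Variables (R : numFieldType) (V : vectType R) (g : {dot V for idfun}).
Variables (U : {vspace V}).

Lemma sub_metric_nondegenerate : nondegenerate (@sub_metric R V g U).
Proof. exact: (dot_nondegenerate (@sub_metric R V g U)). Qed.

(* The image of a form xi on U under U^* = U^flat is the extension of xi by 0 *)
(* to the orthogonal of U.                                                    *)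
Lemma gtan_incl_dual e (y : subvs_of U) : (gtan_incl g U e).2 (vsval y) = e.2 y.
Proof.
case: e => x xi; rewrite gtan_inclE /= flatE -[RHS]/(xi y).
rewrite -{2}[xi](sharpK sub_metric_nondegenerate).
by rewrite (flatE (@sub_metric R V g U)).
Qed.

Lemma gtan_incl_orthov e y : y \in orthov g U -> (gtan_incl g U e).2 y = 0.
Proof.
case: e => x xi /mem_orthovP yU; rewrite gtan_inclE /= flatE hermC.
by rewrite yU ?subvsP // rmorph0 mulr0.
Qed.

End RestrictionTheory.

(* Main.v *)
(* Identifying E_+ and E_- with g through X |-> X +- X^flat, Gamma_u and      *)
(* Gamma_v become conn 1 x = - nabla^+ x and conn (-1) y = - nabla^- y.  For  *)
(* x in h, the orthogonal complement of g' = [g, g], the operators conn 1 x   *)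
(* and conn (-1) x are mutually adjoint and kill x, so the Einstein equations *)
(* at x = y say that the squared norm of conn 1 x is zero.  Its symmetric     *)
(* part is that of ad x and its skew part is H(x, ., .) / 2, so ad x is skew  *)
(* and H(x, ., .) = 0.  Then conn s x = 0, conn s y x = [y, x], and all       *)
(* conn s y take values in g', so the remaining equations are those of g' and *)
(* those saying that delta kills [h, g'] and its flat.                        *)
Require Import Defs.
From mathcomp Require Import all_boot all_order all_algebra reals ring.

Set Implicit Arguments.
Unset Strict Implicit.
Unset Printing Implicit Defensive.

Import Order.TTheory GRing.Theory Num.Theory.
Local Open Scope ring_scope.

(** Write [V'] for the derived algebra and [h] for its orthogonal complement. After identifying both
    eigenspaces with the Lie algebra, [generalised_einsteinP] turns the curvature equations into:
    the trace of [conn (-1) y \o conn 1 x] plus a value of [delta] vanishes, for all x and y.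

    A vector x of [h] is orthogonal to every bracket, so [conn 1 x] and [conn (-1) x] are adjoint to
    each other and kill x. At y = x only the squared norm of [conn 1 x] survives, and definiteness
    of [g] gives [conn 1 x = 0]; its symmetric and skew parts say that ad x is skew and that H(x, .,
    .) = 0 ([einstein_orthov]). Skewness in turn makes [h] Abelian ([skew_abelian]).

    Conversely, given these two properties, [conn s x] takes values in [V'], depends only on the
    [V']-component of x, and restricts to the corresponding operator of [V']. The only further
    contributions are values of [delta] on brackets of [V'] with [h], so the equations separate
    ([einstein_splitP]). The semidirect decomposition is that of an ideal with an Abelian complement
    ([semidirect_abelian_complement]). *)

Section LieAlgebra.
Variables (R : fieldType) (V : vectType R) (b : lieAlgebra V).

(** The Jacobi identity in derivation form, as needed to make ad an action. *)
Lemma bracket_der x y z : b x (b y z) = b (b x y) z + b y (b x z).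
Proof.
rewrite (bracketC b (b x y)) (bracketC b x z) linearNr /=.
apply/eqP; rewrite -subr_eq0 opprD !opprK [b z _ + _]addrC addrA.
by rewrite bracket_jacobi.
Qed.

(** The kernel of [f] is a subspace, so it contains the span once it contains the generating
    brackets. *)
Lemma brv_eq0 (f : dual V) (U W : {vspace V}) :
    {in U & W, forall x y, f (b x y) = 0} -> {in brv b U W, forall x, f x = 0}.
Proof.
move=> f0 x; suff /subvP/(_ x) : (brv b U W <= lker f)%VS.
  by move=> sub /sub; rewrite memv_ker => /eqP.
apply/span_subvP => _ /allpairsP[[u w] /= [uU wW ->]].
by rewrite memv_ker f0 ?vbasis_mem.
Qed.

(** * An ideal with an Abelian complement gives a semidirect product *)

Section AbelianComplement.
Variables (U K : {vspace V}) (bU : lie_closed b U).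
Hypotheses (UKV : (U + K = fullv)%VS) (UK0 : (U :&: K = 0)%VS).
Hypothesis ideal : forall x, {in U, forall y, b x y \in U}.
Hypothesis bK0 : {in K &, forall x y, b x y = 0}.

(** The acting factor is to be the coordinate space itself, so it is identified with [K] through a
    basis. *)
Definition lcomb_basis : 'Hom('rV[R]_(\dim K), V) :=
  linfun (fun r : 'rV_(\dim K) => \sum_i r 0 i *: (vbasis K)`_i).

Definition coord_basis : 'Hom(V, 'rV[R]_(\dim K)) :=
  linfun (fun x => \row_i coord (vbasis K) i x).

Lemma lcomb_basisE r : lcomb_basis r = \sum_i r 0 i *: (vbasis K)`_i.
Proof.
rewrite linfunE // => a u v; rewrite scaler_sumr -big_split.
by apply: eq_bigr => i _ /=; rewrite !mxE scalerDl scalerA.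
Qed.

Lemma coord_basisE x : coord_basis x = \row_i coord (vbasis K) i x.
Proof. by rewrite linfunE // => a u v; apply/rowP => i; rewrite !mxE linearP. Qed.

Lemma lcomb_basis_mem r : lcomb_basis r \in K.
Proof.
rewrite lcomb_basisE rpred_sum // => i _.
by rewrite rpredZ ?vbasis_mem ?mem_nth ?size_tuple.
Qed.

Lemma coord_basisK : {in K, cancel coord_basis lcomb_basis}.
Proof.
move=> x xK; rewrite lcomb_basisE coord_basisE [RHS](coord_vbasis xK).
by apply: eq_bigr => i _; rewrite mxE.
Qed.

Lemma lcomb_basisK : cancel lcomb_basis coord_basis.
Proof.
move=> r; rewrite lcomb_basisE coord_basisE; apply/rowP => i.
by rewrite mxE coord_sum_free // (basis_free (vbasisP K)).
Qed.

Definition complement_action_fun (r : 'rV[R]_(\dim K)) : 'End(subvs_of U) :=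
  (linfun (vsproj U) \o ad b (lcomb_basis r) \o incl U)%VF.

Definition complement_action : 'Hom('rV[R]_(\dim K), 'End(subvs_of U)) :=
  linfun complement_action_fun.

Lemma complement_actionE r a :
  vsval (complement_action r a) = b (lcomb_basis r) (vsval a).
Proof.
have funE s c : vsval (complement_action_fun s c) = b (lcomb_basis s) (vsval c).
  by rewrite !comp_lfunE lfunE /= adE inclE vsprojK ?ideal ?subvsP.
rewrite /complement_action linfunE ?funE // => k s s'; apply/lfunP => c.
apply: subvs_inj; rewrite add_lfunE scale_lfunE linearP /= !funE.
by rewrite linearP linearPl.
Qed.

Lemma complement_action_der r (a a' : subvs_of U) :
  complement_action r (sub_lie bU a a') =
  sub_lie bU (complement_action r a) a' + sub_lie bU a (complement_action r a').
Proof.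
apply: subvs_inj; rewrite complement_actionE [RHS]linearD /= !sub_bracketE //.
by rewrite !complement_actionE bracket_der.
Qed.

Lemma complement_action_hom (r r' : 'rV[R]_(\dim K)) a :
  complement_action (abelian_lie _ r r') a =
  complement_action r (complement_action r' a) -
  complement_action r' (complement_action r a).
Proof.
apply: subvs_inj; rewrite [LHS]complement_actionE [RHS]linearB /=.
rewrite !complement_actionE [X in _ = X - _]bracket_der addrK.
rewrite (bK0 (lcomb_basis_mem r) (lcomb_basis_mem r')) linear0l.
(* The Abelian bracket of [r] and [r'] is 0 by conversion. *)
rewrite -[X in b X _]/(lcomb_basis 0).
by rewrite linear0 linear0l.
Qed.

(** The isomorphism sends x to its two components along [U] and [K]. As [K] is Abelian, a bracket
    has no [K]-component, and its mixed terms are the action of [K] on [U]. *)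
Lemma semidirect_abelian_complement :
  exists rho : lieAction (sub_lie bU) (abelian_lie 'rV[R]_(\dim K)),
    lie_isomorphic b (semidirect rho).
Proof.
exists (LieAction complement_action_der complement_action_hom).
pose f : 'Hom(V, (subvs_of U * 'rV[R]_(\dim K))%type) := linfun (fun x =>
  (vsproj U (daddv_pi U K x), coord_basis (daddv_pi K U x))).
have fE x : f x = (vsproj U (daddv_pi U K x), coord_basis (daddv_pi K U x)).
  by rewrite linfunE // => a u v; rewrite !linearP.
have piE x : daddv_pi U K x + daddv_pi K U x = x.
  by rewrite daddv_pi_add // UKV memvf.
have piU x : x \in U -> daddv_pi U K x = x /\ daddv_pi K U x = 0.
  move=> xU; have e := daddv_pi_id UK0 xU; split=> //.
  by apply: (addrI x); rewrite -{1}e piE addr0.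
have KU0 : (K :&: U = 0)%VS by rewrite capvC.
have piK x : x \in K -> daddv_pi U K x = 0 /\ daddv_pi K U x = x.
  move=> xK; have e := daddv_pi_id KU0 xK; split=> //.
  by apply: (addIr x); rewrite -{2}e piE add0r.
exists f => [|x y].
  exists (fun w => vsval w.1 + lcomb_basis w.2) => [x|[a r]].
    by rewrite fE /= vsprojK ?memv_pi // coord_basisK ?memv_pi.
  rewrite fE /= !linearD /=.
  have [-> ->] := piU _ (subvsP a); have [-> ->] := piK _ (lcomb_basis_mem r).
  by rewrite !linear0 addr0 add0r vsvalK lcomb_basisK.
have bKK : b (daddv_pi K U x) (daddv_pi K U y) = 0 by rewrite bK0 ?memv_pi.
have bxyU : b x y \in U.
  rewrite -(piE x) -(piE y) linearDl !linearDr /= bKK.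
  rewrite addr0 (bracketC b (daddv_pi U K x) (daddv_pi K U y)).
by rewrite !(rpredD, rpredN) ?ideal ?memv_pi.
rewrite !fE; have [-> ->] := piU _ bxyU.
congr (_, _); last by rewrite linear0.
apply: subvs_inj; rewrite vsprojK // linearB linearD /= sub_bracketE //.
rewrite !complement_actionE !coord_basisK ?memv_pi // !vsprojK ?memv_pi //.
rewrite -{1}(piE x) -{1}(piE y) linearDl !linearDr /= bKK.
by rewrite addr0 -!addrA; congr (_ + _); rewrite addrC -bracketC.
Qed.

End AbelianComplement.
End LieAlgebra.

(** * Traces of endomorphisms *)

Section Trace.
Variable R : fieldType.

Lemma lftraceC (V W : vectType R) (f : 'Hom(V, W)) (h : 'Hom(W, V)) :
  lftrace (h \o f)%VF = lftrace (f \o h)%VF.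
Proof.
rewrite /lftrace (passmx.mxof_comp _ _ (vbasisP {:W})) mxtrace_mulC.
by rewrite -passmx.mxof_comp ?vbasisP.
Qed.

Lemma lftraceE (V : vectType R) (f : 'End(V)) :
  lftrace f = \sum_i coord (vbasis {:V}) i (f (vbasis {:V})`_i).
Proof. by apply: eq_bigr => i _; rewrite !mxE /= passmx.vecof_delta. Qed.

Lemma lftrace0 (V : vectType R) : lftrace (0 : 'End(V)) = 0.
Proof. by rewrite lftraceE big1 // => i _; rewrite zero_lfunE linear0. Qed.

(** Factor [f] through [U] and exchange the two factors: the trace only sees a subspace containing
    the image. *)
Lemma lftrace_limg (V : vectType R) (U : {vspace V}) (f : 'End(V))
    (k : 'End(subvs_of U)) :
    (forall x, f x \in U) -> (forall x, vsval (k x) = f (vsval x)) ->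
  lftrace f = lftrace k.
Proof.
move=> fU kf; have -> : f = (incl U \o (linfun (vsproj U) \o f))%VF.
  by apply/lfunP => x; rewrite !comp_lfunE inclE lfunE /= vsprojK.
rewrite lftraceC; congr lftrace; apply/lfunP => x; apply: subvs_inj.
by rewrite !comp_lfunE lfunE /= inclE vsprojK ?kf.
Qed.

End Trace.

(** * Orthogonal frames and the norm given by the trace *)

Section Frame.
Variables (R : numFieldType) (V : vectType R) (g : {dot V for idfun}).

Lemma dotC x y : g x y = g y x.
Proof. by rewrite hermC mul1r. Qed.

Lemma dot_eq0 x : g x x = 0 -> x = 0.
Proof. by move/eqP; apply: contraTeq => /(neq0_dnorm_gt0 (s := g))/lt0r_neq0. Qed.

Lemma dot_ge0 x : 0 <= g x x.
Proof.
by have [->|/(neq0_dnorm_gt0 (s := g))/ltW//] := eqVneq x 0; rewrite linear0l.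
Qed.

Lemma dot_ext x y : (forall z, g x z = g y z) -> x = y.
Proof.
move=> xy; apply/eqP; rewrite -subr_eq0; apply/eqP/dot_eq0.
by rewrite linearBl /= xy subrr.
Qed.

(** Gram-Schmidt without normalisation, which would require square roots in [R]. *)
Lemma orthogonal_frame (U : {vspace V}) : exists2 s : seq V,
  {subset s <= U} & {in U, forall x, x = \sum_(e <- s) (g e x / g e e) *: e}.
Proof.
have [n] := ubnP (\dim U); elim: n U => // n IHn U; rewrite ltnS => dimU.
have [U0|U0] := eqVneq U 0%VS.
  by exists [::] => // x; rewrite U0 memv0 big_nil => /eqP.
have [v vU v0] : exists2 v, v \in U & v != 0.
  by exists (vpick U); rewrite ?memv_pick ?vpick0.
have gv0 : g v v != 0 by apply: contra_neq v0 => /dot_eq0.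
(* The dimension drops since [v] lies in [U] but is not orthogonal to itself. *)
have [|s sW sumW] := IHn (U :&: orthov g <[v]>)%VS.
  apply: leq_trans dimU; rewrite ltn_neqAle dimvS ?capvSl // andbT.
  apply: contra_neqN gv0 => /eqP dimE; apply/eqP; rewrite -mem_orthov1.
  suff /capv_idPl/subvP : (U :&: orthov g <[v]>)%VS = U by apply.
  by apply/eqP; rewrite eqEdim capvSl dimE leqnn.
exists (v :: s) => [e|x xU].
  by rewrite inE => /predU1P[->//|/sW]; rewrite memv_cap => /andP[].
rewrite big_cons; set a := (g v x / _ *: v).
apply/eqP; rewrite -subr_eq0 opprD addrA subr_eq0 {1}[x - a]sumW.
  apply/eqP/eq_big_seq => e /sW; rewrite memv_cap mem_orthov1 => /andP[_ /eqP ev].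
  by rewrite linearBr linearZr_LR /= ev mulr0 subr0.
rewrite memv_cap rpredB ?rpredZ //= mem_orthov1 linearBl linearZl_LR /=.
by rewrite (dotC x) -mulrA mulVf // mulr1 subrr.
Qed.

Lemma lftrace_frame (f : 'End(V)) (s : seq V) :
    (forall x, x = \sum_(e <- s) (g e x / g e e) *: e) ->
  lftrace f = \sum_(e <- s) g e (f e) / g e e.
Proof.
move=> sumV; rewrite lftraceE.
under eq_bigr do rewrite [f _]sumV linear_sum /=.
rewrite exchange_big /=; apply: eq_bigr => e _.
rewrite [in RHS](coord_vbasis (memvf e)) [f (\sum_i _)]linear_sum.
rewrite linear_sumr mulr_suml -(coord_vbasis (memvf e)); apply: eq_bigr => i _.
by rewrite !linearZ /= mulrC !mulrA.
Qed.

(** With [B] the adjoint of [A], the trace is the sum of the nonnegative terms g(Ae, Ae) / g(e, e)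
    over a frame. This is where definiteness of [g] enters the Einstein equations. *)
Lemma adjoint_lftrace_eq0 (A B : 'End(V)) :
  (forall x y, g (A x) y = g x (B y)) -> lftrace (B \o A)%VF = 0 -> A = 0.
Proof.
move=> AB; have [s _ /(_ _ (memvf _)) sumV] := orthogonal_frame fullv.
rewrite (lftrace_frame _ sumV) => /eqP; rewrite psumr_eq0 => [/allP s0|e _].
  apply/lfunP => x; rewrite zero_lfunE (sumV x) linear_sum big_seq big1 // => e es.
  (* A vanishing quotient means [A e = 0] or, division by 0 giving 0, [g e e = 0]; in the latter
     case [e = 0]. *)
  rewrite linearZ /=; have := s0 e es.
  rewrite comp_lfunE -AB mulf_eq0 invr_eq0 => /orP[]/eqP/dot_eq0 ->.
    by rewrite scaler0.
  by rewrite (linear0 A) scaler0.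
by rewrite comp_lfunE -AB mulr_ge0 ?invr_ge0 ?dot_ge0.
Qed.

End Frame.

(** * The Einstein equations in terms of the operators [conn] *)

Section Connection.
Variables (R : numFieldType) (V : vectType R) (b : lieAlgebra V).
Variables (H : closed3form b) (g : {symmetric V}).

Lemma form3C x y : H x y = - H y x.
Proof.
apply/eqP; rewrite -addr_eq0; apply/eqP/lfunP => z.
have := form3_alt12 H (x + y) z.
by rewrite linearDl !linearDr /= !add_lfunE !form3_alt12 add0r addr0 zero_lfunE.
Qed.

Lemma form3C23 x y z : H x y z = - H x z y.
Proof.
apply/eqP; rewrite -addr_eq0; apply/eqP.
have := form3_alt23 H x (y + z).
by rewrite linearDr /= add_lfunE !linearD /= !form3_alt23 add0r addr0.
Qed.

(** The symmetric part of a Dorfman bracket is the differential of the pairing, which is constant on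
    invariant sections. *)
Lemma dorfmanC (e f : gtan V) : dorfman H e f = - dorfman H f e.
Proof.
congr (_, _); rewrite /= ?[LHS]bracketC ?[X in _ + X = _]form3C //.
by rewrite opprD opprB.
Qed.

(* [conn s x] is [y |-> - (nabla_y x - s/2 H(x, y))] for the Levi-Civita      *)
(* connection [nabla]; [s = 1] and [s = - 1] give the two operators Gamma.    *)
Definition conn_fun (s : R) (x y : V) : V :=
  2^-1 *: (b x y + sharp g ((flat g y \o ad b x)%VF + (flat g x \o ad b y)%VF
                              + s *: H x y)).

Lemma conn_fun_linear s x : linear (conn_fun s x).
Proof.
move=> a y z; rewrite /conn_fun scalerA (mulrC a) -scalerA -scalerDr.
congr (_ *: _); rewrite linearPr /= scalerDr addrACA; congr (_ + _).
rewrite -linearP; congr (sharp g _); apply/lfunP => w.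
rewrite !(add_lfunE, scale_lfunE, comp_lfunE, adE, linearP, linearPl) /=.
by rewrite /GRing.scale /=; ring.
Qed.

Definition conn (s : R) (x : V) : 'End(V) := linfun (conn_fun s x).

Lemma connE s x y : conn s x y = conn_fun s x y.
Proof. exact/linfunE/conn_fun_linear. Qed.

Hypothesis g0 : nondegenerate g.

(** The Koszul formula, up to sign, with torsion term [s * H x y z]; later computations of [conn]
    rest on it. *)
Lemma conn_formE s x y z :
  g (conn s x y) z =
  2^-1 * (g (b x y) z + g y (b x z) + g x (b y z) + s * H x y z).
Proof.
rewrite connE linearZl_LR linearDl /= -(flatE g (sharp g _)) sharpK //.
by rewrite !(add_lfunE, scale_lfunE, comp_lfunE, adE, flatE) /= !addrA.
Qed.

(** An element of the eigenspace is determined by its vector part, and projecting X + xi gives half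
    of X plus the sharp of xi. For this bracket xi is g(y, [x, .]) + g(x, [y, .]) + H(x, y, .). *)
Lemma pi_plus_dorfman x y :
  vsval (pi_plus g (dorfman H (x, flat g x) (y, - flat g y))) =
  (conn 1 x y, flat g (conn 1 x y)).
Proof.
rewrite pi_plusE // [dorfman _ _ _]surjective_pairing gen_metricE connE.
rewrite /conn_fun /= scale1r.
have -> : ce_diff1 b (- flat g y) x - ce_diff1 b (flat g x) y =
  (flat g y \o ad b x)%VF + (flat g x \o ad b y)%VF :> dual V.
  by rewrite /ce_diff1 comp_lfunNl !opprK.
congr (_, _); rewrite /= [in RHS]linearZ /=; congr (_ *: _).
by rewrite linearD /= sharpK // addrC.
Qed.

Lemma pi_minus_dorfman x y :
  vsval (pi_minus g (dorfman H (y, - flat g y) (x, flat g x))) =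
  (conn (-1) y x, - flat g (conn (-1) y x)).
Proof.
rewrite pi_minusE // [dorfman _ _ _]surjective_pairing gen_metricE connE.
rewrite /conn_fun /= scaleN1r.
have -> : ce_diff1 b (flat g x) y - ce_diff1 b (- flat g y) x =
  - ((flat g x \o ad b y)%VF + (flat g y \o ad b x)%VF) :> dual V.
  by rewrite /ce_diff1 comp_lfunNl !opprK opprD.
set xi := (_ + _ - _ : dual V); have -> : - ((flat g x \o ad b y)%VF
  + (flat g y \o ad b x)%VF) + H y x = - xi by rewrite opprB addrC.
congr (_, _); rewrite /=.
  by rewrite (linearN (sharp g)) opprK.
rewrite [in RHS]linearZ /= -scalerN; congr (_ *: _).
by rewrite (linearD (flat g)) /= sharpK // [in RHS]opprD [RHS]addrC.
Qed.

Lemma lftrace_Gamma x y (u : subvs_of (Eplus g)) (v : subvs_of (Eminus g)) :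
    vsval u = (x, flat g x) -> vsval v = (y, - flat g y) ->
  lftrace (Gamma_minus H v \o Gamma_plus H u)%VF =
  lftrace (conn (-1) y \o conn 1 x)%VF.
Proof.
move=> ux vy.
have linp : linear (fun z : V => vsproj (Eplus g) (z, flat g z)).
  by move=> a z w; rewrite -linearP; congr (vsproj _ (_, _)); rewrite linearP.
have linm : linear (fun z : V => vsproj (Eminus g) (z, - flat g z)).
  move=> a z w; rewrite -linearP; congr (vsproj _ (_, _)).
  by rewrite linearP opprD -scalerN.
pose jp := linfun (fun z : V => vsproj (Eplus g) (z, flat g z)).
pose jm := linfun (fun z : V => vsproj (Eminus g) (z, - flat g z)).
have jpE z : vsval (jp z) = (z, flat g z).
  by rewrite /jp (linfunE linp) vsprojK //; apply/EplusP; exists z.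
have jmE z : vsval (jm z) = (z, - flat g z).
  by rewrite /jm (linfunE linm) vsprojK //; apply/EminusP; exists z.
have Gp z : Gamma_plus H u (jm z) = jp (conn 1 x z).
  apply: subvs_inj; rewrite jpE -pi_plus_dorfman !comp_lfunE inclE jmE -ux.
  by rewrite (linfunE (dorfman_linear H (vsval u))).
have Gm z : Gamma_minus H v (jp z) = jm (conn (-1) y z).
  apply: subvs_inj; rewrite jmE -pi_minus_dorfman !comp_lfunE inclE jpE -vy.
  by rewrite (linfunE (dorfman_linear H (vsval v))).
pose p : 'Hom(subvs_of (Eminus g), V) := linfun (fst \o vsval).
have jmK : cancel p jm.
  move=> w; apply: subvs_inj; rewrite jmE lfunE /=.
  by case/EminusP: (subvsP w) => z ->.
have pK z : p (jm z) = z by rewrite lfunE /= jmE.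
(* The trace is invariant under conjugation by [p], whose inverse is [jm]. *)
rewrite -[RHS](_ : lftrace ((p \o (Gamma_minus H v \o Gamma_plus H u)) \o jm)%VF = _).
  rewrite -[RHS]lftraceC; congr lftrace; apply/lfunP => w.
  by rewrite comp_lfunE [X in jm X]comp_lfunE jmK.
congr lftrace; apply/lfunP => z; rewrite [LHS]comp_lfunE [LHS]comp_lfunE.
by rewrite [X in p X]comp_lfunE Gp Gm pK [RHS]comp_lfunE.
Qed.

(** Skewness of the Dorfman bracket exchanges its arguments in the divergence terms, so each
    curvature is minus the corresponding expression here. *)
Lemma generalised_einsteinP (delta : dual (gtan V)) :
  generalised_einstein H g delta <->
  forall x y (t := lftrace (conn (-1) y \o conn 1 x)%VF),
    t + delta (conn 1 x y, flat g (conn 1 x y)) = 0 /\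
    t + delta (conn (-1) y x, - flat g (conn (-1) y x)) = 0.
Proof.
have RCE x y (u : subvs_of (Eplus g)) (v : subvs_of (Eminus g)) :
    vsval u = (x, flat g x) -> vsval v = (y, - flat g y) ->
    RCplus H delta v u = - (lftrace (conn (-1) y \o conn 1 x)%VF
      + delta (conn 1 x y, flat g (conn 1 x y))) /\
    RCminus H delta u v = - (lftrace (conn (-1) y \o conn 1 x)%VF
      + delta (conn (-1) y x, - flat g (conn (-1) y x))).
  move=> ux vy; rewrite /RCplus /RCminus (lftrace_Gamma ux vy) ux vy.
  rewrite [X in pi_plus g X]dorfmanC [X in pi_minus g X]dorfmanC !linearN /=.
  by rewrite pi_plus_dorfman pi_minus_dorfman !opprD.
split=> [E x y t|E u v].
  have up : (x, flat g x) \in Eplus g by apply/EplusP; exists x.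
  have vm : (y, - flat g y) \in Eminus g by apply/EminusP; exists y.
  have [] := E (Subvs up) (Subvs vm); have [-> ->] := RCE x y (Subvs up) (Subvs vm)
    erefl erefl.
  by move=> /eqP + /eqP; rewrite !oppr_eq0 => /eqP-> /eqP->.
have [x ux] := EplusP _ _ (subvsP u); have [y vy] := EminusP _ _ (subvsP v).
by have [-> ->] := RCE x y u v ux vy; have [-> ->] := E x y; rewrite oppr0.
Qed.

End Connection.

(** * Orthogonal decomposition along a subspace *)

Section Orthogonal.
Variables (R : numFieldType) (V : vectType R) (g : {dot V for idfun}).
Variables (U : {vspace V}).

Lemma capv_orthov : (U :&: orthov g U = 0)%VS.
Proof.
apply/eqP; rewrite -subv0; apply/subvP => x; rewrite memv_cap memv0.
by case/andP=> xU /mem_orthovP/(_ x xU)/dot_eq0->.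
Qed.

Lemma addv_orthov : (U + orthov g U = fullv)%VS.
Proof.
have [s sU sumU] := orthogonal_frame g U.
apply/eqP; rewrite eqEsubv subvf; apply/subvP => x _.
(* [y] is the orthogonal projection of [x] onto [U]. *)
pose y := \sum_(e <- s) (g e x / g e e) *: e.
rewrite -(subrK y x) addrC memv_add //.
  by rewrite /y big_seq rpred_sum // => e /sU eU; rewrite rpredZ.
apply/mem_orthovP => u uU; rewrite linearBl /=.
apply/eqP; rewrite subr_eq0; apply/eqP.
rewrite {1}(sumU u uU) linear_sumr linear_sumlz; apply: eq_bigr => e _.
by rewrite linearZr_LR linearZl_LR /= (dotC g x e); ring.
Qed.

Lemma orth_proj_compl x : x - vsval (orth_proj g U x) \in orthov g U.
Proof.
rewrite comp_lfunE lfunE /= vsprojK ?memv_pi //.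
rewrite -{1}(daddv_pi_add capv_orthov (_ : x \in U + orthov g U)%VS).
  by rewrite addrC addKr memv_pi.
by rewrite addv_orthov memvf.
Qed.

Lemma orth_proj_vsval x : orth_proj g U (vsval x) = x.
Proof.
apply: subvs_inj; rewrite comp_lfunE lfunE /= vsprojK ?memv_pi //.
by rewrite daddv_pi_id ?capv_orthov ?subvsP.
Qed.

Lemma orth_proj_orthov x : x \in orthov g U -> orth_proj g U x = 0.
Proof.
move=> xh; apply: subvs_inj; apply/eqP; rewrite -memv0 -capv_orthov memv_cap.
rewrite subvsP -(subKr x (vsval _)) -opprB rpredN.
by rewrite rpredB // orth_proj_compl.
Qed.

(** Elimination form of the orthogonal decomposition, used to split a vector in place. *)
Lemma orthov_ind (P : V -> Prop) :
    (forall x y, x \in U -> y \in orthov g U -> P (x + y)) ->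
  forall x, P x.
Proof.
move=> PUh x; rewrite -(subrK (vsval (orth_proj g U x)) x) addrC.
by apply: PUh; rewrite ?subvsP ?orth_proj_compl.
Qed.

(** The component of [x] orthogonal to [U] is orthogonal to itself. *)
Lemma orthov_orthov x : {in orthov g U, forall y, g x y = 0} -> x \in U.
Proof.
elim/orthov_ind: x => x y xU yh /(_ y yh); rewrite linearDl /= dotC.
by rewrite (mem_orthovP yh) // add0r => /dot_eq0->; rewrite addr0.
Qed.

End Orthogonal.

(** * Restriction of [conn] and of the divergence to a subalgebra *)

Section SubConnection.
Variables (R : numFieldType) (V : vectType R) (b : lieAlgebra V).
Variables (H : closed3form b) (g : {dot V for idfun}).
Variables (U : {vspace V}) (bU : lie_closed b U).
Local Notation connU := (conn (sub_closed3form bU H) (@sub_metric R V g U)).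

(** Tested against vectors of [U], the Koszul formula only involves data restricted to [U]. The
    membership hypothesis ensures that these tests determine the vector. *)
Lemma sub_connE s x y : conn H g s (vsval x) (vsval y) \in U ->
  vsval (connU s x y) = conn H g s (vsval x) (vsval y).
Proof.
move=> cU; rewrite -(vsprojK cU); congr vsval.
apply: (@dot_ext _ _ (@sub_metric R V g U)) => z.
rewrite conn_formE; last exact: sub_metric_nondegenerate.
rewrite [RHS]/(sub_metric _ _ _) vsprojK // conn_formE; last exact: dot_nondegenerate.
congr (_ * (_ + _ + _ + _ * _)).
- exact: (congr1 (g^~ (vsval z)) (sub_bracketE bU x y)).
- exact: (congr1 (g (vsval y)) (sub_bracketE bU x z)).
- exact: (congr1 (g (vsval x)) (sub_bracketE bU y z)).
- exact: sub_form3E.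
Qed.

Lemma sub_divergenceE (delta : dual (gtan V)) x y :
  sub_divergence g U delta (x, flat (@sub_metric R V g U) y) =
  delta (vsval x, flat g (vsval y)).
Proof.
by rewrite comp_lfunE gtan_inclE flatK //; apply: sub_metric_nondegenerate.
Qed.

Lemma sub_divergenceNE (delta : dual (gtan V)) x y :
  sub_divergence g U delta (x, - flat (@sub_metric R V g U) y) =
  delta (vsval x, - flat g (vsval y)).
Proof.
by rewrite -(linearN (flat (sub_metric g))) sub_divergenceE !linearN.
Qed.

End SubConnection.

(** * The Einstein equations along the complement of the derived algebra *)

Section Orthocomplement.
Variables (R : numFieldType) (V : vectType R) (b : lieAlgebra V).
Variables (H : closed3form b) (g : {dot V for idfun}).
Local Notation V' := (derived b).
Local Notation h := (orthov g V').
Local Notation con := (conn H g).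

Let g0 : nondegenerate g := dot_nondegenerate g.

Lemma conn_dotE s x y z :
  g (con s x y) z =
  2^-1 * (g (b x y) z + g y (b x z) + g x (b y z) + s * H x y z).
Proof. exact: conn_formE. Qed.

Lemma bracket_derived x y : b x y \in V'.
Proof. by rewrite mem_brv ?memvf. Qed.

Lemma dot_orthov_bracket x y z : x \in h -> g x (b y z) = 0.
Proof. by move/mem_orthovP->; rewrite ?bracket_derived. Qed.

Definition skew_orthov := {in h, forall x y z, g (b x y) z = - g y (b x z)}.

Definition horizontal_orthov := {in h, forall x y z, H x y z = 0}.

(** The term g(x, [y, z]) vanishes; of the rest, the part from ad x is symmetric in y and z, and the
    part from [H] is skew. *)
Lemma conn_adjoint x y z : x \in h -> g (con 1 x y) z = g y (con (-1) x z).
Proof.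
move=> xh; rewrite [RHS]dotC !conn_dotE !(dot_orthov_bracket _ _ xh).
by rewrite (form3C23 _ x z y) (dotC g z) (dotC g _ y); ring.
Qed.

Lemma einstein_orthov delta : generalised_einstein H g delta ->
  skew_orthov /\ horizontal_orthov.
Proof.
move=> /(generalised_einsteinP H g0 delta) E.
suff c0 : {in h, forall x y z,
    g (b x y) z + g y (b x z) = 0 /\ H x y z = 0}.
  split=> x xh y z; have [? ?] := c0 x xh y z => //.
  by apply/eqP; rewrite -addr_eq0; apply/eqP.
move=> x xh.
have cxx s : con s x x = 0.
  apply: (dot_ext (g := g)) => w; rewrite linear0l conn_dotE.
  rewrite bracket_alt linear0l !dot_orthov_bracket //.
  by rewrite form3_alt12; ring.
have c1 : con 1 x = 0.
  apply: (adjoint_lftrace_eq0 (g := g) (B := con (-1) x)) => [y z|].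
    exact: conn_adjoint.
  (* At y = x the divergence term is [delta] of 0, leaving only the trace. *)
  have [] := E x x; rewrite cxx linear0.
  by rewrite (_ : (0, 0) = 0) // linear0 addr0.
have c1E y z : g (b x y) z + g y (b x z) + H x y z = 0.
  have := congr1 (fun v => 2 * g v z) (congr1 (fun f : 'End(V) => f y) c1).
  rewrite /= zero_lfunE linear0l mulr0 conn_dotE.
  rewrite (dot_orthov_bracket _ _ xh) => <-.
  by rewrite mulVKf ?pnatr_eq0 //; ring.
(* Exchanging y and z fixes the symmetric part and changes the sign of the [H] part, so each
   vanishes. *)
move=> y z; have := c1E z y; have := c1E y z.
rewrite (form3C23 _ x z y) (dotC g z) (dotC g _ y).
set p := g (b x y) z + _ => pH /eqP.
rewrite (addrC (g y _)) subr_eq0 -/p => /eqP pE.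
have : H x y z = 0.
  have : 2 * H x y z = 0 by rewrite -[RHS]pH pE; ring.
  by move/eqP; rewrite mulf_eq0 pnatr_eq0 => /eqP.
by rewrite pE => ->.
Qed.

(** For x, y in [h], g([x, y], z) = - g(y, [x, z]) = 0, because y is orthogonal to all brackets. *)
Lemma skew_abelian : skew_orthov -> abelian_subalgebra b h.
Proof.
move=> sk; have bh0 : {in h &, forall x y, b x y = 0}.
  move=> x y xh yh; apply: (dot_ext (g := g)) => z.
  by rewrite sk // dot_orthov_bracket // oppr0 linear0l.
by split=> // x y xh yh; rewrite bh0 // mem0v.
Qed.

(** Skewness on [V'] extends to the whole algebra: x commutes with [h], and brackets are orthogonal
    to [h]. *)
Lemma skew_orthovP : abelian_subalgebra b h ->
    {in h, forall x, {in V' &, forall y z, g (b x y) z = - g y (b x z)}} ->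
  skew_orthov.
Proof.
move=> [_ bh0] sk x xh y z.
elim/(orthov_ind (g := g) (U := V')): y => y1 y2 y1V y2h.
elim/(orthov_ind (g := g) (U := V')): z => z1 z2 z1V z2h.
rewrite (linearDr b x y1) (linearDr b x z1) /= (bh0 x y2) // (bh0 x z2) // !addr0.
rewrite linearDr linearDl /= (dotC g _ z2).
rewrite (dot_orthov_bracket _ _ y2h) (dot_orthov_bracket _ _ z2h) !addr0.
exact: sk.
Qed.

(** * Separating the equations when [h] acts skewly and [H] is horizontal *)

Section Split.
Hypotheses (sk : skew_orthov) (hor : horizontal_orthov).

Let sk0 x y z : x \in h -> g y (b x z) = - g (b x y) z.
Proof. by move=> xh; rewrite sk // opprK. Qed.

Lemma horizontal23 x y z : y \in h -> H x y z = 0.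
Proof. by move=> yh; rewrite form3C opp_lfunE hor // oppr0. Qed.

Lemma conn_orthov s x y : x \in h -> con s x y = 0.
Proof.
move=> xh; apply: (dot_ext (g := g)) => z; rewrite linear0l conn_dotE.
by rewrite sk // hor // (dot_orthov_bracket _ _ xh); ring.
Qed.

(** In the Koszul formula g(x, [y, z]) equals g([x, y], z) by skewness of ad y, doubling the first
    term; the others vanish. *)
Lemma conn_orthovr s x y : y \in h -> con s x y = b x y.
Proof.
move=> yh; apply: (dot_ext (g := g)) => z; rewrite conn_dotE.
rewrite horizontal23 // (dot_orthov_bracket _ _ yh) (sk0 _ _ yh) (bracketC b y x) linearNl /=.
by rewrite opprK addr0 mulr0 addr0 -mulr2n -[g _ z *+ _]mulr_natl mulKf ?pnatr_eq0.
Qed.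

(** Paired with z in [h], the two terms g(y, [x, z]) and g(x, [y, z]) cancel by skewness of ad z. *)
Lemma conn_derived s x y : con s x y \in V'.
Proof.
apply: (orthov_orthov (g := g)) => z zh; rewrite conn_dotE.
rewrite (form3C23 H x y) horizontal23 // (dotC g (b x y)) (dot_orthov_bracket _ _ zh).
rewrite !(bracketC b _ z) !linearNr /= (sk0 y x) // (dotC g x).
by ring.
Qed.

Lemma connDl s x x' y : con s (x + x') y = con s x y + con s x' y.
Proof.
apply: (dot_ext (g := g)) => z; rewrite linearDl /= !conn_dotE.
rewrite !(linearDl, linearDr) /= !add_lfunE.
by ring.
Qed.

Local Notation con' := (conn (sub_closed3form (@derived_closed R V b) H)
  (@sub_metric R V g V')).

Let g'0 : nondegenerate (@sub_metric R V g V') :=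
  sub_metric_nondegenerate g V'.

Lemma lftrace_conn_derived (x y : subvs_of V') :
  lftrace (con (-1) (vsval y) \o con 1 (vsval x))%VF =
  lftrace (con' (-1) y \o con' 1 x)%VF.
Proof.
apply: lftrace_limg => z; first by rewrite comp_lfunE conn_derived.
by rewrite !comp_lfunE !sub_connE ?conn_derived.
Qed.

Lemma einstein_splitP (delta : dual (gtan V)) :
  generalised_einstein H g delta <->
  {in brv b h V' &, forall x y, delta (x, flat g y) = 0} /\
  generalised_einstein (sub_closed3form (@derived_closed R V b) H)
    (@sub_metric R V g V') (sub_divergence g V' delta).
Proof.
(* Both parts of [delta] become forms on [V], so that the two equations involve the sum and the
   difference of [dl] and [dr]. *)
pose dl : dual V := (delta \o linfun (fun x => (x, 0) : gtan V))%VF.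
pose dr : dual V := (delta \o linfun (fun x => (0, flat g x) : gtan V))%VF.
have dE x y : delta (x, flat g y) = dl x + dr y.
  have l1 : linear (fun x => (x, 0) : gtan V).
    by move=> a u v; congr (_, _); rewrite /= scaler0 addr0.
  have l2 : linear (fun x => (0, flat g x) : gtan V).
    by move=> a u v; congr (_, _); rewrite /= ?scaler0 ?addr0 ?linearP.
  rewrite !comp_lfunE (linfunE l1) (linfunE l2) -linearD.
  by congr (delta (_, _)); rewrite /= ?addr0 ?add0r.
have dEN x y : delta (x, - flat g y) = dl x - dr y by rewrite -linearN dE linearN.
split=> [/(generalised_einsteinP H g0 delta) E|
         [d0 /(generalised_einsteinP _ g'0) E]].
- split.
    have d0 : {in brv b h V', forall x, dl x = 0} /\
        {in brv b h V', forall x, dr x = 0}.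
      suff d0 : {in h & V', forall x y, dl (b x y) = 0 /\ dr (b x y) = 0}.
        by split; apply: brv_eq0 => x y xh yV; have [] := d0 x y xh yV.
      move=> x y xh yV.
      have c0 s : con s x = 0.
        by apply/lfunP => z; rewrite zero_lfunE conn_orthov.
      (* As [conn s x] is 0, both traces vanish; what remains is [dl - dr] and [dl + dr] at
         [y, x]. *)
      have := (E x y).2; have := (E y x).1.
      rewrite !c0 comp_lfun0l comp_lfun0r !conn_orthovr // dE dEN.
      rewrite !lftrace0 !add0r (bracketC b y x) !linearN /= opprK.
      set p := dl _; set q := dr _ => /eqP; rewrite -opprD oppr_eq0 addr_eq0.
      move=> /eqP-> /eqP; rewrite opprK -mulr2n mulrn_eq0 /= => /eqP->.
      by rewrite oppr0.
    by move=> x y xV yV; rewrite dE d0.1 // d0.2 // addr0.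
  apply/(generalised_einsteinP _ g'0) => x y t.
  have [] := E (vsval x) (vsval y).
  rewrite /t lftrace_conn_derived sub_divergenceE sub_divergenceNE.
  by rewrite !sub_connE ?conn_derived.
have dl0 : {in brv b h V', forall x, dl x = 0}.
  by move=> x xV; have := d0 x 0 xV (mem0v _); rewrite dE linear0 addr0.
have dr0 : {in brv b h V', forall x, dr x = 0}.
  by move=> x xV; have := d0 0 x (mem0v _) xV; rewrite dE linear0 add0r.
apply/(generalised_einsteinP H g0 delta) => x y t.
elim/(orthov_ind (g := g) (U := V')): x @t => x1 x2 x1V x2h.
elim/(orthov_ind (g := g) (U := V')): y => y1 y2 y1V y2h t.
have conD s u v z : v \in h -> con s (u + v) z = con s u z.
  by move=> vh; rewrite connDl [con s v z]conn_orthov // addr0.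
have brh u v : u \in V' -> v \in h -> b u v \in brv b h V'.
  by move=> uV vh; rewrite bracketC rpredN mem_brv.
(* The [h]-components do not affect the trace; in the divergence terms they only add brackets in
   [[h], [V']], which [dl] and [dr] kill. *)
have -> : t = lftrace (con (-1) y1 \o con 1 x1)%VF.
  by congr lftrace; apply/lfunP => z; rewrite !comp_lfunE !conD.
rewrite dE dEN (conD 1) // (conD (-1)) // !linearD /=.
rewrite (conn_orthovr _ _ y2h) (conn_orthovr _ _ x2h).
rewrite !(dl0 (b _ _)) ?brh // !(dr0 (b _ _)) ?brh // !oppr0 !addr0.
have [] := E (vsproj V' x1) (vsproj V' y1).
rewrite sub_divergenceE sub_divergenceNE -lftrace_conn_derived.
rewrite !sub_connE ?conn_derived // !vsprojK // !dE dEN => E1 E2.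
by split.
Qed.

(** By alternation [H] vanishes when any one argument lies in [h], so each argument may be replaced
    by its [V']-component. *)
Lemma form3_orth_proj x y z :
  H x y z = sub_form3 H (orth_proj g V' x) (orth_proj g V' y) (orth_proj g V' z).
Proof.
rewrite sub_form3E.
elim/(orthov_ind (g := g) (U := V')): x => x x' xV x'h.
elim/(orthov_ind (g := g) (U := V')): y => y y' yV y'h.
elim/(orthov_ind (g := g) (U := V')): z => z z' zV z'h.
have pD u u' : u \in V' -> u' \in h -> vsval (orth_proj g V' (u + u')) = u.
  move=> uV u'h; rewrite -{1}(vsprojK uV) linearD /= orth_proj_vsval.
  by rewrite orth_proj_orthov // addr0 vsprojK.
rewrite !pD // !linearDl !linearDr /= !add_lfunE !linearD /=.
rewrite !(hor x'h) !(horizontal23 _ _ y'h) !addr0.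
by rewrite (form3C23 H x y z') (horizontal23 _ _ z'h) oppr0 addr0.
Qed.

End Split.

End Orthocomplement.

Theorem theorem3p1 (R : realType) (V : vectType R) (b : lieAlgebra V)
    (H : closed3form b) (g : {dot V for idfun}) (delta : dual (gtan V)) :
  let V' : {vspace V} := derived b in
  let h : {vspace V} := orthov g V' in
  (generalised_einstein H g delta <->
    [/\ abelian_subalgebra b h /\
          {in h, forall X, {in V' &, forall Y Z, g (b X Y) Z = - g Y (b X Z)}},
        {in brv b h V' &, forall X Y, delta (X, flat g Y) = 0},
        {in h, forall X, forall Y Z, H X Y Z = 0}
      & generalised_einstein
          (sub_closed3form (@derived_closed R V b) H)
          (@sub_metric R V g V') (sub_divergence g V' delta)])
  /\
  (generalised_einstein H g delta ->
    (exists rho : lieAction (derived_lie b) (abelian_lie 'rV[R]_(\dim h)),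
        lie_isomorphic b (semidirect rho)) /\
    (forall X Y Z, H X Y Z =
       sub_form3 H (orth_proj g V' X) (orth_proj g V' Y) (orth_proj g V' Z))).
Proof.
move=> V' h; split.
  split=> [E|[[ab sk] d0 hor E]].
    have [sk hor] := einstein_orthov E.
    have [d0 E'] := (einstein_splitP sk hor delta).1 E.
    split=> //; split; first exact: skew_abelian.
    by move=> x xh y z _ _; apply: sk.
  by apply/(einstein_splitP (skew_orthovP ab sk) hor).
move=> E; have [sk hor] := einstein_orthov E; split; last exact: form3_orth_proj.
have [_ bh0] := skew_abelian sk.
apply: semidirect_abelian_complement => //.
- exact: addv_orthov.
- exact: capv_orthov.
- by move=> x y _; apply: bracket_derived.
Qed.
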